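(* Let $n\ge3$. The map $\zeta_D^*:\mathcal L_{n-1,n}\to\mathcal B_{2n-1}$ defined by $\zeta_D^*(\pi^* )=(\zeta_D(\pi))^*$ for all $\pi\in\mathcal L^\bullet_{n-1,n}$ is well defined and is a bijection.
   Context: $\mathcal L_{n-1,n}$ is the set of words in $\{N,E\}$ with $n-1$ letters $E$ and $n$ letters $N$; $\mathcal B_{2n-1}$ is the set of words of length $2n-1$ in $\{N,E\}$ all of whose prefixes contain at least as many $N$'s as $E$'s. A signed lattice path is an element of $\mathcal L_{n-1,n}$ in which, if the first step is $E$, this step is replaced by $E^+$ or $E^-$ (still counted as an East step); the set is $\mathcal L^\bullet_{n-1,n}$, and $\epsilon(\pi)=-1$ if $\pi$ contains $E^-$, else $1$. A signed ballot path is an element of $\mathcal B_{2n-1}$ in which, if the $n$-th North step is immediately followed by an East step, that East step is replaced by $E^+$ or $E^-$. For a signed path $\rho$, $\rho^*$ is the path obtained by replacing $E^+,E^-$ by $E$. For $\pi\in\mathcal L^\bullet_{n-1,n}$: $\pi_i$ = number of East steps before the $i$-th North step; $\lambda_1=\epsilon(\pi)\pi_1$, $\lambda_i=\pi_i$ ($1<i<n$), $\lambda_n=2\pi_n-\pi_{n-1}$ if $\pi_1+\dots+\pi_{n-2}$ even, $2n-1-2\pi_n+\pi_{n-1}$ if odd; area vector $\mu=(\lambda_1,\lambda_2-1,\dots,\lambda_{n-1}-(n-2),\lambda_n-(n-1))$ if $n-1\equiv0,3\pmod4$ and $\mu=(-\lambda_1,\lambda_2-1,\dots,\lambda_{n-1}-(n-2),n-\lambda_n)$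 if $n-1\equiv1,2\pmod4$. For $a\in\mathbb Z^n$, $j\ge0$: $\overrightarrow{S}^+_j(a)$ reads $a$ left to right writing $N$ for entries $j$, $E$ for entries $j+1$; $\overleftarrow{S}^+_j(a)$ reads right to left; $\overrightarrow{S}^-_j,\overleftarrow{S}^-_j$ likewise with $N$ for $-j$, $E$ for $-j-1$. $\zeta_D(\pi)$ is obtained from $\overleftarrow{S}^-_{2n-1}(\mu)\overrightarrow{S}^+_{2n-1}(\mu)\cdots\overleftarrow{S}^-_0(\mu)\overrightarrow{S}^+_0(\mu)$ by deleting the last letter and, if the $n$-th North step is immediately followed by an East step, replacing that East step by $E^+$ if $\#\{r:\mu_r>0\}$ is even and $E^-$ if odd. *)

(* Defs.v *)
From HB Require Import structures.
From mathcomp Require Import all_boot all_order all_algebra.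

Set Implicit Arguments.
Unset Strict Implicit.
Unset Printing Implicit Defensive.

Import Order.TTheory GRing.Theory Num.Theory.

Variant step := North | East.

Definition is_north (s : step) : bool := if s is North then true else false.
Definition step_of_bool (b : bool) : step := if b then North else East.
Lemma is_northK : cancel is_north step_of_bool. Proof. by case. Qed.
HB.instance Definition _ := Finite.copy step (can_type is_northK).

Variant sstep := Unsigned of step | EastPlus | EastMinus.

Definition forget_sign (s : sstep) : step :=
  if s is Unsigned t then t else East.

Definition is_unsigned (s : sstep) : bool :=
  if s is Unsigned _ then true else false.

Definition is_minus (s : sstep) : bool :=
  if s is EastMinus then true else false.

Definition star (r : seq sstep) : seq step := map forget_sign r.

Definition is_lattice (n : nat) (w : seq step) : bool :=
  (count_mem East w == n.-1) && (count_mem North w == n).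

Definition is_ballot (m : nat) (w : seq step) : bool :=
  (size w == m) &&
  all (fun k => count_mem East (take k w) <= count_mem North (take k w))
      (iota 0 m.+1).

(* An initial East step must carry a sign; no other step may. *)
Definition is_signed_lattice (n : nat) (r : seq sstep) : bool :=
  is_lattice n (star r) &&
  (if r is s :: r' then
     (if s is Unsigned East then false else true) && all is_unsigned r'
   else true).

Definition lattice_path (n : nat) := {w : seq step | is_lattice n w}.
Definition ballot_path (m : nat) := {w : seq step | is_ballot m w}.
Definition signed_lattice_path (n : nat) :=
  {r : seq sstep | is_signed_lattice n r}.

Lemma star_is_lattice (n : nat) (p : signed_lattice_path n) :
  is_lattice n (star (val p)).
Proof. by have /andP[] := valP p. Qed.

Definition star_lattice (n : nat) (p : signed_lattice_path n) :
  lattice_path n := exist _ (star (val p)) (star_is_lattice p).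

(* Position (from 0) of the i-th North step, i >= 1; [size w] if there is
   no such step. *)
Definition north_pos (w : seq step) (i : nat) : nat :=
  nth (size w) [seq k <- iota 0 (size w) | nth East w k == North] i.-1.

(* pi_i, with i >= 1 *)
Definition easts_before (w : seq step) (i : nat) : nat :=
  count_mem East (take (north_pos w i) w).

Section AreaVector.
Local Open Scope ring_scope.

Definition epsilon (r : seq sstep) : int :=
  if has is_minus r then - 1 else 1.

(* Indices i of [lambda] and [mu] range over 1, ..., n. *)
Definition lambda (n : nat) (r : seq sstep) (i : nat) : int :=
  let p k := easts_before (star r) k in
  if i == 1%N then epsilon r * (p 1%N)%:Z
  else if (i < n)%N then (p i)%:Z
  else if odd (\sum_(1 <= k < n.-1) p k)
       then 2 * n%:Z - 1 - 2 * (p n)%:Z + (p n.-1)%:Z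
       else 2 * (p n)%:Z - (p n.-1)%:Z.

Definition mu (n : nat) (r : seq sstep) (i : nat) : int :=
  let l := lambda n r in
  if (n.-1 %% 4)%N \in [:: 0; 3]%N then l i - (i.-1)%:Z
  else if i == 1%N then - l i
  else if (i < n)%N then l i - (i.-1)%:Z
  else n%:Z - l i.

Definition area_vector (n : nat) (r : seq sstep) : seq int :=
  [seq mu n r i | i <- iota 1 n].

(* Read a from left to right, writing North for entries x and East for
   entries y. *)
Definition read (x y : int) (a : seq int) : seq step :=
  pmap (fun z => if z == x then Some North
                 else if z == y then Some East else None) a.

Definition read_plus_right (j : nat) (a : seq int) : seq step :=
  read j%:Z (j%:Z + 1) a.

Definition read_minus_left (j : nat) (a : seq int) : seq step :=
  read (- j%:Z) (- j%:Z - 1) (rev a).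

(* The levels j run from 2n-1 down to 0. *)
Definition zeta_word (n : nat) (a : seq int) : seq step :=
  flatten [seq read_minus_left j a ++ read_plus_right j a
          | j <- rev (iota 0 (2 * n))].

Definition zetaD (n : nat) (r : seq sstep) : seq sstep :=
  let a := area_vector n r in
  let w := zeta_word n a in
  let v := take (size w).-1 w in
  let k := (north_pos v n).+1 in
  let s := if odd (count (fun z => 0 < z) a) then EastMinus else EastPlus in
  if nth North v k == East
  then set_nth (Unsigned North) (map Unsigned v) k s
  else map Unsigned v.

End AreaVector.

Definition is_zetaD_star (n : nat)
    (f : lattice_path n -> ballot_path (2 * n).-1) : Prop :=
  forall p : signed_lattice_path n,
    val (f (star_lattice p)) = star (zetaD n (val p)).

(* Main.v *)
Require Import Defs.
From HB Require Import structures.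
From mathcomp Require Import all_boot all_order all_algebra.
From mathcomp Require Import zify.

Set Implicit Arguments.
Unset Strict Implicit.
Unset Printing Implicit Defensive.

Import Order.TTheory GRing.Theory Num.Theory.

(* Let [d_i = pi_i - (i-1)] for [i < n], and let [d_n] be [mu_n] if [mu_n <= 0]
   and [1 - mu_n] otherwise.  The levels of [mu] and [d] spell the same word up to
   its last letter: changing the sign of [mu_1] moves its letters across the
   boundary between [S^-_j] and [S^+_j], and [y -> 1 - y] on the final entry moves
   them across the other boundaries.  Now [d] starts with a nonnegative entry, ends
   with a nonpositive one, and drops by at most 1 at each step; hence every
   level reading is empty or ends with [North].  Since the East steps of one level
   are counted by the North steps of the next one, the readings can be recovered
   from the right end of the word: each is the longest suffix with a known number
   of North steps.  The readings determine [d]: at a first difference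
   [x < y] of two such sequences, the second one meets [x+1] before [x].  This
   gives injectivity, and surjectivity follows by counting ballot paths. *)

(** * Counting ballot paths *)

Fixpoint words (m : nat) : seq (seq step) :=
  if m is m'.+1
  then map (cons North) (words m') ++ map (cons East) (words m')
  else [:: [::]].

Lemma mem_words (m : nat) (w : seq step) : (w \in words m) = (size w == m).
Proof.
elim: m w => [|m IHm] [|s w] //=.
  by rewrite mem_cat; apply/norP; split; apply/mapP => -[].
rewrite eqSS -IHm mem_cat; apply/orP/idP => [|wm].
  by case=> /mapP[v vm [_ ->]].
by case: s; [left | right]; apply: map_f.
Qed.

Lemma uniq_words (m : nat) : uniq (words m).
Proof.
elim: m => //= m IHm.
rewrite cat_uniq !map_inj_uniq ?IHm ?andbT; try by move=> ? ? [].
by apply/hasPn => _ /mapP[v _ ->]; apply/mapP => -[].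
Qed.

Fixpoint ballot_from (h : nat) (w : seq step) : bool :=
  match w with
  | [::] => true
  | North :: w' => ballot_from h.+1 w'
  | East :: w' => if h is h'.+1 then ballot_from h' w' else false
  end.

Lemma ballot_fromP (h : nat) (w : seq step) :
  (forall k, k <= size w ->
     count_mem East (take k w) <= h + count_mem North (take k w)) ->
  ballot_from h w.
Proof.
elim: w h => [|[] w IHw] [|h] //= Hw.
- by apply: IHw => k kw; have := Hw k.+1 kw; rewrite /=; lia.
- by apply: IHw => k kw; have := Hw k.+1 kw; rewrite /=; lia.
- by have := Hw 1 isT; rewrite /= take0.
- by apply: IHw => k kw; have := Hw k.+1 kw; rewrite /=; lia.
Qed.

Definition central (m h : nat) (w : seq step) : bool :=
  (m <= (count_mem North w).*2 + h) && ((count_mem North w).*2 <= m + h + 1).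

(* Reflection principle: the ballot paths from height [h] are equinumerous with
   the words whose displacement lies in [[-h, h+1]]. *)
Lemma count_ballot_from (m h : nat) :
  count (ballot_from h) (words m) = count (central m h) (words m).
Proof.
elim: m h => [|m IHm] h; first by rewrite /= /central /= !addn0; lia.
rewrite /= !count_cat !count_map.
have -> : count (preim (cons North) (ballot_from h)) (words m) =
          count (central m h.+1) (words m) by rewrite -IHm.
case: h => [|h].
  have -> : count (preim (cons East) (ballot_from 0)) (words m) = 0.
    by apply/eqP; rewrite -leqn0 leqNgt -has_count; apply/hasPn.
  (* After a leading North the rest must have displacement in [-1, 0], after a leading East in
     [1, 2]; together these fill [-1, 2], the range of [central m 1]. *)
  elim: (words m) => //= w ws; rewrite /central /=; lia.
have -> : count (preim (cons East) (ballot_from h.+1)) (words m) =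
          count (central m h) (words m) by rewrite -IHm.
(* The ranges left by North and East are [-h-2, h+1] and [-h, h+3]; they cover each value as often
   as [-h-2, h+3] and [-h, h+1] do. *)
elim: (words m) => //= w ws; rewrite /central /=; lia.
Qed.

Lemma size_count_step (w : seq step) :
  size w = count_mem North w + count_mem East w.
Proof. by elim: w => [|[] w] //= ->; lia. Qed.

Lemma count_ballot_lattice (n : nat) : 0 < n ->
  count (is_ballot (2 * n).-1) (words (2 * n).-1) <=
  count (is_lattice n) (words (2 * n).-1).
Proof.
move=> n0; set m := (2 * n).-1.
(* From height 0 the displacement is 0 or 1, and the odd length [m] forces 1. *)
have -> : count (is_lattice n) (words m) = count (central m 0) (words m).
  apply: eq_in_count => w; rewrite mem_words /central /is_lattice => /eqP.
  by rewrite size_count_step /m; lia.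
rewrite -count_ballot_from; apply: sub_count => w /andP[/eqP sw /allP Hw].
apply: ballot_fromP => k kw; apply: Hw.
by rewrite mem_iota /= add0n ltnS -sw.
Qed.

(** * Descending concatenations and their unique decomposition *)

(* Concatenation [f (K-1) ++ ... ++ f 1 ++ f 0]. *)
Fixpoint desc_cat (f : nat -> seq step) (K : nat) : seq step :=
  if K is K'.+1 then desc_cat (fun k => f k.+1) K' ++ f 0 else [::].

(** The default [North] lets the empty word qualify. *)
Notation ends_north w := (last North w = North).

Lemma ends_north_cat (u v : seq step) :
  ends_north u -> ends_north v -> ends_north (u ++ v).
Proof. by rewrite last_cat => ->. Qed.

Lemma ends_north_desc_cat (f : nat -> seq step) (K : nat) :
  (forall k, ends_north (f k)) -> ends_north (desc_cat f K).
Proof.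
elim: K f => //= K IHK f Hf.
by apply: ends_north_cat => //; apply: IHK.
Qed.

(** The piece between the two cuts contains no North, yet it is a suffix of the longer left part,
    which ends with North; so it is empty. *)
Lemma cat_north_inj (u v u' v' : seq step) :
  ends_north u -> ends_north u' -> count_mem North v = count_mem North v' ->
  u ++ v = u' ++ v' -> u = u' /\ v = v'.
Proof.
wlog le_uu' : u v u' v' / size u' <= size u.
  move=> Hw Hu Hu' Hc E; case/orP: (leq_total (size u') (size u)) => le.
    exact: Hw.
  by have [] := Hw u' v' u v le Hu' Hu (esym Hc) (esym E).
move=> Hu Hu' Hc E.
have Eu : u = u' ++ drop (size u') u.
  rewrite -{1}(cat_take_drop (size u') u); congr (_ ++ _).
  have := congr1 (take (size u')) E.
  by rewrite takel_cat // take_size_cat.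
set t := drop _ u in Eu.
have Ev : v' = t ++ v.
  by move: E; rewrite Eu -catA => /eqP; rewrite eqseq_cat // => /andP[_ /eqP].
have t0 : t = [::].
  have : count_mem North t = 0 by move: Hc; rewrite Ev count_cat; lia.
  case/lastP: t Eu {Ev} => // t s Eu.
  move: Hu; rewrite Eu last_cat last_rcons => ->.
  by rewrite -cats1 count_cat /= addn1.
by rewrite Eu Ev t0 cats0.
Qed.

(** The East steps of levels 0 to K-1 are counted by the North steps of levels 2 to K+1, and the sum
    telescopes. *)
Lemma count_desc_cat (f : nat -> seq step) (K : nat) :
  (forall k, count_mem East (f k) = count_mem North (f k.+2)) ->
  count_mem North (desc_cat f K) + count_mem North (f K) +
    count_mem North (f K.+1) =
  count_mem East (desc_cat f K) + count_mem North (f 0) + count_mem North (f 1).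
Proof.
elim: K f => [|K IHK] f east_f /=; first by lia.
have := IHK (fun k => f k.+1) (fun k => east_f k.+1).
by rewrite !count_cat (east_f 0) /=; lia.
Qed.

(** A prefix stopping inside level k takes at most as many East steps there as level k+2 has North
    steps, a surplus that [count_desc_cat] grants to the levels above k. *)
Lemma ballot_desc_cat (f : nat -> seq step) (K i : nat) :
  (forall k, count_mem East (f k) = count_mem North (f k.+2)) ->
  count_mem East (take i (desc_cat f K)) <=
  count_mem North (take i (desc_cat f K)) +
  count_mem North (f K) + count_mem North (f K.+1).
Proof.
elim: K f i => [|K IHK] f i east_f //=.
have IH i0 := IHK (fun k => f k.+1) i0 (fun k => east_f k.+1).
have /= Hc := count_desc_cat K (fun k => east_f k.+1).
rewrite take_cat; set u := desc_cat _ _ in IH Hc *; set t := take (i - _) _.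
case: ltnP => _; first exact: IH.
have le_t : count_mem East t <= count_mem East (f 0).
  by rewrite -(cat_take_drop (i - size u) (f 0)) count_cat leq_addr.
move: le_t Hc; rewrite (east_f 0) !count_cat.
by do !move: (count _ _) => ?; lia.
Qed.

(** Two known North counts drive the induction: the first one isolates [f 0], whose East steps then
    give the North count of [f 2]. *)
Lemma desc_cat_inj (f g : nat -> seq step) (K : nat) :
  (forall k, count_mem East (f k) = count_mem North (f k.+2)) ->
  (forall k, count_mem East (g k) = count_mem North (g k.+2)) ->
  (forall k, ends_north (f k)) -> (forall k, ends_north (g k)) ->
  count_mem North (f 0) = count_mem North (g 0) ->
  count_mem North (f 1) = count_mem North (g 1) ->
  desc_cat f K = desc_cat g K -> forall k, k < K -> f k = g k.
Proof.
elim: K f g => //= K IHK f g Ef Eg Lf Lg f0 f1 E.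
have [E' E0] : desc_cat (fun k => f k.+1) K = desc_cat (fun k => g k.+1) K /\
               f 0 = g 0.
  by apply: cat_north_inj E => //; apply: ends_north_desc_cat.
case=> // k kK; apply: (IHK (fun k => f k.+1) (fun k => g k.+1)) => //.
by rewrite -Ef -Eg E0.
Qed.

(** * Readings of an integer sequence *)

Local Open Scope ring_scope.

Lemma read_cat (x y : int) (a b : seq int) :
  read x y (a ++ b) = read x y a ++ read x y b.
Proof. exact: pmap_cat. Qed.

Lemma read1 (x y z : int) :
  read x y [:: z] =
  if z == x then [:: North] else if z == y then [:: East] else [::].
Proof. by rewrite /read /=; case: (z == x) => //; case: (z == y). Qed.

Lemma read_cons (x y z : int) (a : seq int) :
  read x y (z :: a) =
  (if z == x then [:: North] else if z == y then [:: East] else [::]) ++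
  read x y a.
Proof. by rewrite -read1 -read_cat. Qed.

Lemma read_rev (x y : int) (a : seq int) :
  read x y (rev a) = rev (read x y a).
Proof.
elim: a => // z a IHa; rewrite rev_cons -cats1 read_cat IHa /=.
by case: eqP => _ /=; [|case: eqP => _ /=]; rewrite ?rev_cons -?cats1 ?cats0.
Qed.

(** Brings the plus readings to the form [read (x + 1) x], which the minus readings have after
    reversal. *)
Lemma read_swap (x y : int) (a : seq int) : x != y ->
  read y x a = map (fun s => step_of_bool (~~ is_north s)) (read x y a).
Proof.
move=> xy; elim: a => // z a IHa; rewrite !read_cons map_cat -IHa.
case: eqP => [->|_]; first by rewrite eq_sym (negPf xy).
by case: eqP.
Qed.

Lemma count_read_north (x y : int) (a : seq int) :
  count_mem North (read x y a) = count_mem x a.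
Proof. by elim: a => //= z a <-; case: eqP => //= _; case: eqP. Qed.

Lemma count_read_east (x y : int) (a : seq int) : x != y ->
  count_mem East (read x y a) = count_mem y a.
Proof.
move=> xy; elim: a => //= z a <-; case: eqP => [->|_] /=.
  by rewrite (negPf xy).
by case: eqP.
Qed.

(** Interleaving the signs, with index 2j for the plus and 2j+1 for the minus reading, makes
    [zeta_word] a single descending concatenation where East steps at k match North steps at k+2. *)
Definition seg (a : seq int) (k : nat) : seq step :=
  if odd k then read_minus_left k./2 a else read_plus_right k./2 a.

Lemma zeta_word_desc_cat (n : nat) (a : seq int) :
  zeta_word n a = desc_cat (seg a) (2 * n).*2.
Proof.
have E M (g : nat -> seq step) :
    flatten [seq g j.*2.+1 ++ g j.*2 | j <- rev (iota 0 M)] = desc_cat g M.*2.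
  elim: M g => //= M IHM g.
  rewrite rev_cons map_rcons -cats1 flatten_cat /= cats0 catA.
  by rewrite -(IHM (fun k => g k.+2)) (iotaDl 1 0) -map_rev -map_comp.
rewrite -E /zeta_word; congr flatten; apply: eq_map => j.
by rewrite /seg /= odd_double /= uphalf_double doubleK.
Qed.

Lemma seg_east (a : seq int) (k : nat) :
  count_mem East (seg a k) = count_mem North (seg a k.+2).
Proof.
rewrite /seg /= negbK; case: (odd k); rewrite /read_minus_left /read_plus_right.
  rewrite count_read_north count_read_east ?count_rev; last by lia.
  by have -> : - k./2%:Z - 1 = - k./2.+1%:Z by lia.
rewrite count_read_north count_read_east ?count_rev; last by lia.
by have -> : k./2%:Z + 1 = k./2.+1%:Z by lia.
Qed.

(** * Sequences dropping by at most 1 at each step *)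

Notation slow_descent a := (sorted (fun x y : int => x - 1 <= y) a).

(** Discrete intermediate values: starting above [x], the sequence meets [x + 1] before it can reach
    [x]. *)
Lemma read_north_first (x y : int) (a : seq int) :
  slow_descent (y :: a) -> x < y -> head North (read (x + 1) x (y :: a)) = North.
Proof.
elim: a y => [|z a IHa] y; rewrite read_cons.
  by move=> _ xy; case: eqP => //= _; case: eqP => // yx; move: xy; rewrite yx ltxx.
move=> /= /andP[yz za] xy; case: eqP => // yx1.
case: eqP => [yx|_]; first by move: xy; rewrite yx ltxx.
by apply: IHa => //; lia.
Qed.

(** Ending at or below [x], the sequence must pass through [x] after every [x + 1]. *)
Lemma read_north_last (x y : int) (a : seq int) :
  slow_descent (rcons a y) -> y <= x -> ends_north (read x (x + 1) (rcons a y)).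
Proof.
elim/last_ind: a y => [|a z IHa] y; rewrite -cats1 read_cat read1.
  move=> _ yx; case: eqP => // _; case: eqP => // yx1.
  by move: yx; rewrite yx1 gerDl.
move=> sa yx; case: eqP => [_|nyx]; first by rewrite last_cat.
case: eqP => [yx1|_]; first by move: yx; rewrite yx1 gerDl.
move: sa; rewrite cat_rcons sorted_cat_cons /= andbT cats0 => /andP[sa zy].
by apply: IHa => //; lia.
Qed.

Lemma slow_descent_inj (a b : seq int) :
  slow_descent a -> slow_descent b ->
  (forall x, read (x + 1) x a = read (x + 1) x b) -> a = b.
Proof.
have read_head x c : read (x + 1) x (x :: c) = East :: read (x + 1) x c.
  rewrite read_cons; case: eqP => [|_]; first by lia.
  by rewrite eqxx.
(* The left reading begins with East; by [read_north_first] the right one is empty or begins with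
   North. *)
have lt_head x y c d : slow_descent (y :: d) -> x < y ->
    read (x + 1) x (x :: c) <> read (x + 1) x (y :: d).
  move=> sd xy; rewrite read_head => E.
  by have := read_north_first sd xy; rewrite -E.
elim: a b => [|x a IHa] [|y b] // sa sb Hab.
- by have := Hab y; rewrite read_head.
- by have := Hab x; rewrite read_head.
have Exy : x = y.
  case: (ltgtP x y) => // xy; first by case: (lt_head x y a b sb xy (Hab x)).
  by case: (lt_head y x b a sa xy (esym (Hab y))).
rewrite -Exy in sb Hab *; congr (_ :: _).
apply: IHa; [exact: path_sorted sa|exact: path_sorted sb|] => z.
have /eqP := Hab z; rewrite read_cons (read_cons _ _ _ b) eqseq_cat //.
by case/andP=> _ /eqP.
Qed.

Lemma slow_descent_seg_inj (a b : seq int) :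
  slow_descent a -> slow_descent b -> seg a =1 seg b -> a = b.
Proof.
(* A level x = j >= 0 comes from the plus reading with letters exchanged, and x = -j-1 from the
   reversed minus reading. *)
move=> sa sb Hab; apply: slow_descent_inj => // -[j|j].
  have := Hab j.*2; rewrite /seg odd_double doubleK /read_plus_right => E.
  have nj : j%:Z != j%:Z + 1 by lia.
  by rewrite !(read_swap _ nj) E.
have := Hab j.*2.+1; rewrite /seg /= odd_double /= uphalf_double.
rewrite /read_minus_left !read_rev => /(congr1 rev); rewrite !revK.
by have [-> ->] : Negz j + 1 = - j%:Z /\ Negz j = - j%:Z - 1 by lia.
Qed.

(** A minus reading runs right to left, so its last letter is governed by the head of [a]; that of a
    plus reading is governed by the last entry. *)
Lemma ends_north_seg (a : seq int) (k : nat) :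
  slow_descent a -> 0 <= head 0 a -> last 0 a <= 0 -> ends_north (seg a k).
Proof.
case: a => [|x a]; first by rewrite /seg; case: odd.
move=> sa /= x0 a0; rewrite /seg; case: odd.
  rewrite /read_minus_left read_rev.
  have := @read_north_first (- k./2%:Z - 1) x a sa.
  have -> : - k./2%:Z - 1 + 1 = - k./2%:Z by lia.
  case: (read _ _ _) => //= s w; rewrite rev_cons last_rcons; apply; lia.
by rewrite /read_plus_right lastI; apply: read_north_last; [rewrite -lastI|lia].
Qed.

(** * Length, ballot property and injectivity of the zeta word *)

Notation bounded M a := (all (fun z : int => `|z| < M)%N a).

Lemma seg_out (M : nat) (a : seq int) (k : nat) :
  bounded M a -> (M.*2 <= k)%N -> seg a k = [::].
Proof.
move=> /allP Ha Mk; have kM : (M <= k./2)%N by lia.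
have out x : (M <= `|x|)%N -> count_mem x a = 0%N.
  by move=> Mx; apply/count_memPn; apply/negP => /Ha; lia.
apply: size0nil; rewrite size_count_step /seg; case: odd.
  by rewrite /read_minus_left count_read_north count_read_east ?count_rev ?out //; lia.
by rewrite /read_plus_right count_read_north count_read_east ?out //; lia.
Qed.

Lemma size_desc_cat (f : nat -> seq step) (K : nat) :
  size (desc_cat f K) = (\sum_(k < K) size (f k))%N.
Proof.
elim: K f => [|K IHK] f /=; first by rewrite big_ord0.
by rewrite big_ord_recl size_cat IHK addnC.
Qed.

Lemma size_seg_cons (z : int) (a : seq int) (k : nat) :
  size (seg (z :: a) k) = (size (seg [:: z] k) + size (seg a k))%N.
Proof.
rewrite -[z :: a]cat1s /seg; case: odd.
  by rewrite /read_minus_left !read_rev !size_rev read_cat size_cat.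
by rewrite /read_plus_right read_cat size_cat.
Qed.

Lemma size_seg1 (z : int) (k : nat) :
  size (seg [:: z] k) =
  if odd k then ((z == - k./2%:Z)%R + (z == - k./2%:Z - 1)%R)%N
  else ((z == k./2%:Z)%R + (z == k./2%:Z + 1)%R)%N.
Proof.
have size1 x y : x != y -> size (read x y [:: z]) = ((z == x) + (z == y))%N.
  by rewrite read1; case: (z =P x) => [-> /negPf -> //|_ _]; case: eqP.
rewrite /seg; case: odd; last by apply: size1; lia.
by rewrite /read_minus_left read_rev size_rev; apply: size1; lia.
Qed.

(** Each entry writes two letters: a nonzero [z] gives North at level |z| and East at level |z|-1,
    while 0 gives North in both readings of level 0. *)
Lemma size_zeta_word (n : nat) (a : seq int) :
  bounded (2 * n) a -> size (zeta_word n a) = (2 * size a)%N.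
Proof.
rewrite zeta_word_desc_cat size_desc_cat.
elim: a => [|z a IHa] /=.
  by move=> _; rewrite big1 // => k _; rewrite /seg; case: odd.
case/andP=> zM /IHa IH; under eq_bigr do rewrite size_seg_cons.
rewrite big_split /= IH.
(* Below level [M], an entry with |z| = M > 0 has written only its East; the second summand records
   it. *)
suff -> M : (\sum_(k < M.*2) size (seg [:: z] k))%N =
    ((`|z| < M)%N.*2 + ((`|z| == M)%N && (0 < M)%N))%N by lia.
elim: M => [|M IHM]; first by rewrite big_ord0; lia.
rewrite doubleS !big_ord_recr /= IHM !size_seg1 /= odd_double /= doubleK uphalf_double.
lia.
Qed.

Lemma ballot_zeta_word (n : nat) (a : seq int) (i : nat) :
  bounded (2 * n) a ->
  (count_mem East (take i (zeta_word n a)) <=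
   count_mem North (take i (zeta_word n a)))%N.
Proof.
move=> ba; rewrite zeta_word_desc_cat.
have := ballot_desc_cat (2 * n).*2 i (seg_east a).
by rewrite !(seg_out ba) ?addn0 //; lia.
Qed.

Lemma zeta_word_inj (n : nat) (a b : seq int) :
  slow_descent a -> 0 <= head 0 a -> last 0 a <= 0 -> bounded (2 * n) a ->
  slow_descent b -> 0 <= head 0 b -> last 0 b <= 0 -> bounded (2 * n) b ->
  zeta_word n a = zeta_word n b -> a = b.
Proof.
move=> sa ha la ba sb hb lb bb; rewrite !zeta_word_desc_cat => E.
have seg01 c : count_mem North (seg c 1) = count_mem North (seg c 0).
  by rewrite /seg /= /read_minus_left /read_plus_right !count_read_north count_rev.
(* The top levels are empty, so North minus East is twice the number of zeros: the word gives the
   two initial counts for [desc_cat_inj]. *)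
have Ha := count_desc_cat (2 * n).*2 (seg_east a).
have Hb := count_desc_cat (2 * n).*2 (seg_east b).
move: Ha Hb; rewrite !(seg_out _ (leqnn _), seg_out _ (leqnSn _)) // !seg01 E => Ha Hb.
have E0 : count_mem North (seg a 0) = count_mem North (seg b 0) by move: Ha Hb => /=; lia.
apply: slow_descent_seg_inj => // k; case: (ltnP k (2 * n).*2) => [|Kk].
  apply: desc_cat_inj E k; try exact: seg_east; rewrite ?seg01 //.
    by move=> k; apply: ends_north_seg.
  by move=> k; apply: ends_north_seg.
by rewrite (seg_out ba Kk) (seg_out bb Kk).
Qed.

(** * Invariance under changes of the first and last entries *)

Lemma zeta_word_oppr_head (n : nat) (x : int) (a : seq int) :
  zeta_word n (- x :: a) = zeta_word n (x :: a).
Proof.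
congr flatten; apply: eq_map => j.
(* The first entry is read last in the minus reading and first in the plus reading, so both places
   are adjacent. *)
rewrite /read_minus_left /read_plus_right !rev_cons -!cats1 !read_cat.
rewrite !(read_cons _ _ _ a) -!catA; congr (_ ++ _); rewrite !catA; congr (_ ++ _).
by rewrite !read1; do ?[case: eqP => ?] => //; lia.
Qed.

(* A final entry [-j] writes, at the same two places between consecutive levels,
   the letters that a final entry [j+1] writes; only the last letter of the word
   can tell them apart. *)
Lemma zeta_word_reflect_last (n j : nat) (a : seq int) : (j.+1 < 2 * n)%N ->
  exists w, zeta_word n (rcons a (- j%:Z)) = w ++ read 0 1 [:: - j%:Z] /\
            zeta_word n (rcons a (j%:Z + 1)) = w ++ read 0 1 [:: j%:Z + 1].
Proof.
move=> jn.
pose lev M b := flatten [seq read_minus_left k b ++ read_plus_right k b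
                        | k <- rev (iota 0 M)].
(* This is the letter of the final entry closing the plus reading of level [M]; it is adjacent to
   the one opening the minus reading of level [M - 1], so the two are compared together. *)
pose top M y := read M%:Z (M%:Z + 1) [:: y].
have lev_rcons M y : lev M.+1 (rcons a y) =
    read (- M%:Z) (- M%:Z - 1) [:: y] ++
    (read_minus_left M a ++ read_plus_right M a) ++
    top M y ++ lev M (rcons a y).
  rewrite /lev -addn1 iotaD rev_cat /= /read_minus_left /read_plus_right.
  by rewrite rev_rcons -[y :: rev a]cat1s -cats1 !read_cat -!catA.
suff /(_ (2 * n)%N) [w] : forall M, exists w,
    top M (- j%:Z) ++ lev M (rcons a (- j%:Z)) = w ++ read 0 1 [:: - j%:Z] /\
    top M (j%:Z + 1) ++ lev M (rcons a (j%:Z + 1)) = w ++ read 0 1 [:: j%:Z + 1].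
  have top0 y : y \in [:: - j%:Z; j%:Z + 1] -> top (2 * n)%N y = [::].
    by rewrite !inE /top read1; do ?[case: eqP => ?] => //; lia.
  by rewrite !top0 ?inE ?eqxx ?orbT //; exists w.
elim=> [|M [w [E1 E2]]]; first by exists [::]; rewrite /top /lev /= !cats0.
set u := read_minus_left M a ++ read_plus_right M a in lev_rcons.
exists (top M.+1 (- j%:Z) ++ read (- M%:Z) (- M%:Z - 1) [:: - j%:Z] ++ u ++ w).
rewrite !lev_rcons E1 E2 -!catA; split=> //; rewrite !catA; do 3 congr (_ ++ _).
by rewrite /top !read1; do ?[case: eqP => ?] => //; lia.
Qed.

(** * East counts before the North steps *)

Section Heights.
Local Open Scope nat_scope.

Fixpoint heights (e : nat) (w : seq step) : seq nat :=
  match w with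
  | [::] => [::]
  | North :: w' => e :: heights e w'
  | East :: w' => heights e.+1 w'
  end.

Lemma size_heights (e : nat) (w : seq step) :
  size (heights e w) = count_mem North w.
Proof. by elim: w e => [|[] w IHw] e //=; rewrite IHw. Qed.

Lemma heights_bounds (e : nat) (w : seq step) :
  all (fun h => e <= h <= e + count_mem East w) (heights e w).
Proof.
elim: w e => [|[] w IHw] e //=.
  by rewrite leqnn leq_addr /= add0n.
by apply: sub_all (IHw e.+1) => h /= /andP[le_h h_le]; rewrite ltnW //=; lia.
Qed.

Lemma sorted_heights (e : nat) (w : seq step) : sorted leq (heights e w).
Proof.
elim: w e => [|[] w IHw] e //=.
rewrite path_min_sorted ?IHw //.
by apply: sub_all (heights_bounds e w) => h /andP[].
Qed.

(** The heights miss only the East steps after the last North step; the equal East counts supply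
    them. *)
Lemma heights_inj (e : nat) (w w' : seq step) :
  count_mem East w = count_mem East w' -> heights e w = heights e w' -> w = w'.
Proof.
have lt_head e0 v v' : heights e0.+1 v <> e0 :: v'.
  by move=> E; have := heights_bounds e0.+1 v; rewrite E /= ltnn.
elim: w e w' => [|s w IHw] e w'.
  elim: w' e => [|[] w' IHw'] e //=.
case: s w' => [[|[] w']|[|[] w']] //=.
- by move=> c [/(IHw _ _ c) ->].
- by move=> _ /esym /lt_head.
- by move=> _ /lt_head.
- by move=> /addnI c /(IHw _ _ c) ->.
Qed.

Lemma easts_before_heights (w : seq step) (i : nat) :
  0 < i <= count_mem North w -> easts_before w i = nth 0 (heights 0 w) i.-1.
Proof.
case: i => // i /= iw; rewrite /easts_before /north_pos /=.
suff gen e : e + count_mem East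
    (take (nth (size w) [seq k <- iota 0 (size w) | nth East w k == North] i) w) =
    nth 0 (heights e w) i by rewrite -gen.
elim: w e i iw => // s w IHw e i.
rewrite /= (iotaDl 1 0) filter_map.
rewrite (@eq_filter _ _ (fun k => nth East w k == North)) //.
set np := filter _ _.
(* The default of [nth] depends on the word, so the index must be shown to be in range. *)
have out k : k < count_mem North w ->
    nth (size w).+1 [seq 1 + j | j <- np] k = (nth (size w) np k).+1.
  move=> kw; rewrite (nth_map (size w)) //; apply: leq_trans kw _.
  rewrite size_filter -(count_map (nth East w) (pred1 North)).
  by rewrite -[map _ _]/(mkseq (nth East w) (size w)) mkseq_nth.
case: s => /=.
  case: i => [|i] iw; first by rewrite addn0.
  by rewrite -[nth _ _ _]/(nth _ [seq 1 + j | j <- np] i) out //= -(IHw e).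
by move=> iw; rewrite out //= -(IHw e.+1) // addnA addn1.
Qed.
End Heights.

Lemma easts_before_bounds (n : nat) (w : seq step) :
  (0 < n)%N -> is_lattice n w ->
  (forall i, (0 < i < n)%N -> (easts_before w i <= easts_before w i.+1)%N) /\
  (easts_before w n <= n.-1)%N.
Proof.
move=> n0 /andP[/eqP cE /eqP cN]; split=> [[|i] // /andP[_ iN]|].
  rewrite !easts_before_heights ?cN //=; try lia.
  have := sorted_heights 0 w; move/(sortedP 0%N); apply.
  by rewrite size_heights cN.
rewrite easts_before_heights ?cN ?n0 ?leqnn //.
have := heights_bounds 0 w; move/(all_nthP 0%N)/(_ n.-1).
by rewrite size_heights cN cE; case: n n0 {cN cE} => //= n _ /(_ (ltnSn n)).
Qed.

(** * The folded area vector *)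

Definition mu_last (n : nat) (w : seq step) : int := mu n (map Unsigned w) n.

(** The sign enters only the first entry, so any lift of the path has the same last one. *)
Lemma mu_star_last (n : nat) (r : seq sstep) :
  (1 < n)%N -> mu n r n = mu_last n (star r).
Proof.
move=> n1; have n1F : (n == 1%N) = false by lia.
have starK : star (map Unsigned (star r)) = star r.
  by rewrite /star -map_comp map_id.
by rewrite /mu_last /mu /lambda n1F ltnn starK.
Qed.

(** In all cases the entry is y = 2 pi_n - pi_{n-1} - (n-1) or 1 - y, and pi_{n-1} <= pi_n <= n-1
    puts y in [x-1, 1-x]. The stated interval is symmetric under z -> 1 - z, so folding keeps the
    lower bound. *)
Lemma mu_last_bounds (n : nat) (w : seq step) : (2 < n)%N -> is_lattice n w ->
  let x := (easts_before w n.-1)%:Z - (n.-2)%:Z in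
  x - 1 <= mu_last n w <= 2 - x.
Proof.
move=> n3 Lw /=; have [|mono le_n] := easts_before_bounds _ Lw; first by lia.
have := mono n.-1; rewrite prednK; last by lia.
rewrite /mu_last /mu /lambda; have -> : (n == 1%N) = false by lia.
rewrite ltnn /star -map_comp map_id.
by case: (_ \in _); case: odd; lia.
Qed.

Definition reflect_pos (y : int) : int := if y <= 0 then y else 1 - y.

Definition area_init (n : nat) (w : seq step) : seq int :=
  [seq (easts_before w i)%:Z - (i.-1)%:Z | i <- iota 1 n.-1].

(** The sequence [d]. *)
Definition folded_area (n : nat) (w : seq step) : seq int :=
  rcons (area_init n w) (reflect_pos (mu_last n w)).

Lemma size_folded_area (n : nat) (w : seq step) :
  (0 < n)%N -> size (folded_area n w) = n.
Proof. by move=> n0; rewrite size_rcons size_map size_iota prednK. Qed.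

Lemma nth_area_init (n i : nat) (w : seq step) : (i < n.-1)%N ->
  nth 0 (area_init n w) i = (easts_before w i.+1)%:Z - i%:Z.
Proof. by move=> lt_i; rewrite (nth_map 0%N) ?size_iota // nth_iota // add1n. Qed.

Lemma nth_folded_area (n i : nat) (w : seq step) : (i < n)%N ->
  nth 0 (folded_area n w) i =
  if (i < n.-1)%N then (easts_before w i.+1)%:Z - i%:Z
  else reflect_pos (mu_last n w).
Proof.
move=> lt_i; rewrite nth_rcons size_map size_iota.
case: ifP => [/nth_area_init -> //|lt_i']; case: eqP => //; lia.
Qed.

Section Lattice.
Variables (n : nat) (w : seq step).
Hypotheses (n3 : (2 < n)%N) (w_lattice : is_lattice n w).

Lemma slow_descent_folded_area : slow_descent (folded_area n w).
Proof.
apply/(sortedP 0) => i; rewrite size_folded_area; last by lia.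
have [|mono _] := easts_before_bounds _ w_lattice; first by lia.
move=> lt_i; rewrite !nth_folded_area; try lia.
have -> : (i < n.-1)%N by lia.
case: ifP => [lt_i'|ge_i]; first by have := mono i.+1; lia.
have := mu_last_bounds n3 w_lattice; have -> : n.-1 = i.+1 by lia.
by rewrite /reflect_pos /=; case: ifP; lia.
Qed.

Lemma folded_area_head : 0 <= head 0 (folded_area n w).
Proof. by rewrite -nth0 nth_folded_area; [case: ifP; lia|lia]. Qed.

Lemma folded_area_last : last 0 (folded_area n w) <= 0.
Proof. by rewrite last_rcons /reflect_pos; case: ifP; lia. Qed.

Lemma easts_before_le (i : nat) : (easts_before w i <= n.-1)%N.
Proof.
have /andP[/eqP <- _] := w_lattice.
by rewrite /easts_before -[X in (_ <= count _ X)%N](cat_take_drop (north_pos w i))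
  count_cat leq_addr.
Qed.

Lemma mu_last_le : mu_last n w < n%:Z + 1.
Proof. by have := mu_last_bounds n3 w_lattice; rewrite /=; lia. Qed.

Lemma bounded_folded_area : bounded (2 * n) (folded_area n w).
Proof.
apply/(all_nthP 0) => i; rewrite size_folded_area; last by lia.
move=> lt_i; rewrite nth_folded_area //.
case: ifP => [lt_i'|_]; first by have := easts_before_le i.+1; lia.
have /= := mu_last_bounds n3 w_lattice.
by rewrite /reflect_pos; case: ifP; lia.
Qed.

End Lattice.

(** Folding the last entry loses nothing: the parity of mu_n is fixed by the earlier pi_i, and y and
    1 - y have opposite parities. *)
Lemma folded_area_inj (n : nat) (w w' : seq step) : (2 < n)%N ->
  is_lattice n w -> is_lattice n w' ->
  folded_area n w = folded_area n w' -> w = w'.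
Proof.
move=> n3 Lw Lw' /rcons_inj[Ei El].
have Ep i : (0 < i < n)%N -> easts_before w i = easts_before w' i.
  case: i => // i lt_i; have lt_i' : (i < n.-1)%N by lia.
  have := nth_area_init w lt_i'; rewrite Ei nth_area_init //; lia.
have Es : (\sum_(1 <= k < n.-1) easts_before w k =
           \sum_(1 <= k < n.-1) easts_before w' k)%N.
  by apply: eq_big_nat => k k_n; apply: Ep; lia.
have En : easts_before w n = easts_before w' n.
  move: El; rewrite /mu_last /mu /lambda; have -> : (n == 1%N) = false by lia.
  rewrite ltnn /star -!map_comp !map_id Es (Ep n.-1); last by lia.
  rewrite /reflect_pos; case: (_ \in _); case: odd; do 2 (case: ifP => ?); lia.
have /andP[/eqP cE /eqP cN] := Lw; have /andP[/eqP cE' /eqP cN'] := Lw'.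
apply: (@heights_inj 0); first by rewrite cE cE'.
apply: (@eq_from_nth _ 0%N) => [|i]; rewrite !size_heights ?cN ?cN' // => lt_i.
have := @easts_before_heights w i.+1; have := @easts_before_heights w' i.+1.
rewrite cN cN' lt_i /= => <- // <- //.
by have [->|ne] := eqVneq i.+1 n; [|apply: Ep; lia].
Qed.

(** * The map on unsigned paths *)

Lemma star_zetaD (n : nat) (r : seq sstep) :
  star (zetaD n r) = take (size (zeta_word n (area_vector n r))).-1
                          (zeta_word n (area_vector n r)).
Proof.
rewrite /zetaD; set v := take _ _; set k := (north_pos v n).+1.
have starU u : star (map Unsigned u) = u by rewrite /star -map_comp map_id.
(* The default [North] differs from East, so [k] lies inside [v] and [set_nth] does not lengthen
   it. *)
case: eqP => // Ek; have lt_k : (k < size v)%N.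
  by case: ltnP => // le_k; move: Ek; rewrite nth_default.
set s := if _ then EastMinus else EastPlus.
have Es : forget_sign s = East by rewrite /s; case: ifP.
apply: (@eq_from_nth _ North) => [|i].
  by rewrite size_map size_set_nth size_map (maxn_idPr lt_k).
rewrite size_map size_set_nth size_map (maxn_idPr lt_k) => lt_i.
rewrite (nth_map (Unsigned North)) ?size_set_nth ?size_map ?(maxn_idPr lt_k) //.
rewrite nth_set_nth /=; case: eqP => [->|_]; first by rewrite Es Ek.
by rewrite (nth_map North).
Qed.

Lemma area_vector_rcons (n : nat) (r : seq sstep) : (2 < n)%N ->
  let x := head 0 (area_init n (star r)) in
  let a := behead (area_init n (star r)) in
  area_vector n r = rcons (x :: a) (mu_last n (star r)) \/
  area_vector n r = rcons (- x :: a) (mu_last n (star r)).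
Proof.
case: n => [|[|n]] // n3.
have Ei : iota 1 n.+2 = rcons (1%N :: iota 2 n) n.+2.
  by rewrite -[n.+2 in LHS]addn1 iotaD cats1 add1n.
rewrite /area_vector Ei map_rcons mu_star_last //=.
set x := _ - _; set a := [seq mu _ _ i | i <- _].
have Ea : a = [seq (easts_before (star r) i)%:Z - (i.-1)%:Z | i <- iota 2 n].
  apply/eq_in_map => i; rewrite mem_iota /mu /lambda => i_n.
  have -> : (i == 1%N) = false by lia.
  have -> : (i < n.+2)%N by lia.
  by case: ifP.
rewrite -Ea; suff [->|->] : mu n.+2 r 1 = x \/ mu n.+2 r 1 = - x by [left|right].
rewrite /x /mu /lambda /= /epsilon.
by case: (_ \in _); case: has; lia.
Qed.

Definition zeta_star (n : nat) (w : seq step) : seq step :=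
  take (2 * n).-1 (zeta_word n (folded_area n w)).

Section ZetaStar.
Variables (n : nat) (w : seq step).
Hypotheses (n3 : (2 < n)%N) (w_lattice : is_lattice n w).

Lemma size_zeta_folded : size (zeta_word n (folded_area n w)) = (2 * n)%N.
Proof.
rewrite size_zeta_word; last exact: bounded_folded_area.
by rewrite size_folded_area //; lia.
Qed.

(** As every level is empty or ends with North, the deleted letter is always North and can be
    restored. *)
Lemma zeta_word_folded :
  zeta_word n (folded_area n w) = rcons (zeta_star n w) North.
Proof.
have := ends_north_desc_cat (f := seg (folded_area n w)) (2 * n).*2.
have := size_zeta_folded; rewrite -zeta_word_desc_cat /zeta_star.
case/lastP: (zeta_word _ _) => [|u s]; first by rewrite /=; lia.
rewrite size_rcons last_rcons => Eu ->; last first.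
  by move=> k; apply: ends_north_seg;
    [exact: slow_descent_folded_area | exact: folded_area_head
    | exact: folded_area_last].
by rewrite -Eu /= -[X in take _ X]cats1 take_size_cat.
Qed.

Lemma zeta_star_ballot : is_ballot (2 * n).-1 (zeta_star n w).
Proof.
rewrite /is_ballot size_take size_zeta_folded; have -> : ((2 * n).-1 < 2 * n)%N by lia.
rewrite eqxx; apply/allP => k; rewrite mem_iota => /andP[_ lt_k].
rewrite /zeta_star take_takel; last by lia.
exact/ballot_zeta_word/bounded_folded_area.
Qed.

Lemma star_zetaD_zeta_star (r : seq sstep) :
  star r = w -> star (zetaD n r) = zeta_star n w.
Proof.
move=> Er; rewrite star_zetaD; set x := head 0 (area_init n w).
have -> : zeta_word n (area_vector n r) =
          zeta_word n (rcons (area_init n w) (mu_last n w)).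
  have -> : area_init n w = x :: behead (area_init n w).
    by rewrite /x /area_init; case: n n3 => [|[|m]].
  have := area_vector_rcons r n3; rewrite Er -/x /= => -[] -> //.
  exact: zeta_word_oppr_head.
rewrite /zeta_star /folded_area /reflect_pos; have := size_zeta_folded.
rewrite /folded_area /reflect_pos; case: ifP => [_ -> //|y0].
have [j Ej] : exists j : nat, mu_last n w = j%:Z + 1.
  by exists `|mu_last n w - 1|%N; lia.
have jn : (j.+1 < 2 * n)%N by have := mu_last_le n3 w_lattice; lia.
have -> : 1 - mu_last n w = - j%:Z by lia.
rewrite Ej; have [u [-> ->]] := zeta_word_reflect_last (area_init n w) jn.
(* For j = 0 the two words differ in their last letter, which is deleted; for j > 0 they
   coincide. *)
rewrite !read1; case: j {Ej jn} => [|j] Hs.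
  have Eu : size u = (2 * n).-1 by move: Hs; rewrite size_cat /=; lia.
  by rewrite size_cat addn1 /= -Eu !take_size_cat.
by move: Hs; do ?[case: eqP => ?]; try lia; rewrite !cats0 => ->.
Qed.
End ZetaStar.

(** * Bijectivity *)

Lemma zeta_star_inj (n : nat) (w w' : seq step) : (2 < n)%N ->
  is_lattice n w -> is_lattice n w' -> zeta_star n w = zeta_star n w' -> w = w'.
Proof.
move=> n3 Lw Lw' E; apply: (folded_area_inj n3 Lw Lw').
apply: (@zeta_word_inj n); try exact: slow_descent_folded_area;
  try exact: folded_area_head; try exact: folded_area_last;
  try exact: bounded_folded_area.
by rewrite !zeta_word_folded // E.
Qed.

Lemma zeta_star_surj (n : nat) (v : seq step) : (2 < n)%N ->
  is_ballot (2 * n).-1 v -> exists2 w, is_lattice n w & zeta_star n w = v.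
Proof.
move=> n3 Bv; set m := (2 * n).-1.
pose L := filter (is_lattice n) (words m); pose B := filter (is_ballot m) (words m).
have uL : uniq [seq zeta_star n w | w <- L].
  rewrite map_inj_in_uniq ?filter_uniq ?uniq_words // => w w'.
  by rewrite !mem_filter => /andP[Lw _] /andP[Lw' _]; apply: zeta_star_inj.
have LB : {subset [seq zeta_star n w | w <- L] <= B}.
  move=> _ /mapP[w + ->]; rewrite !mem_filter => /andP[Lw _].
  have := zeta_star_ballot n3 Lw; rewrite mem_words => Bw; rewrite Bw.
  by case/andP: Bw.
have le_BL : (size B <= size [seq zeta_star n w | w <- L])%N.
  by rewrite size_map !size_filter; apply: count_ballot_lattice; lia.
(* An injective image of [L] inside [B], with [B] no larger, is all of [B]. *)
have [_ EB] := uniq_min_size uL LB le_BL.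
have : v \in B by rewrite mem_filter Bv mem_words; case/andP: Bv.
rewrite -EB => /mapP[w]; rewrite mem_filter => /andP[Lw _] ->.
by exists w.
Qed.

(** Having a signed lift for every path makes [is_zetaD_star] determine the map. *)
Lemma star_lattice_surj (n : nat) (w : lattice_path n) :
  exists r, star_lattice r = w.
Proof.
case: w => w Lw.
pose r := if w is s :: w' then
    (if s is East then EastPlus else Unsigned North) :: map Unsigned w'
  else [::].
have Er : star r = w.
  rewrite /r; case: (w) => // s w'; rewrite /star /= -map_comp map_id.
  by case: s.
have Sr : is_signed_lattice n r.
  rewrite /is_signed_lattice Er Lw /r; case: (w) => // s w' /=.
  by rewrite all_map; case: s => //=; apply/allP.
by exists (exist _ r Sr); apply: val_inj.
Qed.

Local Close Scope ring_scope.

Theorem theorem5p24 (n : nat) (hn : 3 <= n) :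
  exists f : lattice_path n -> ballot_path (2 * n).-1,
    [/\ is_zetaD_star f,
        (forall g : lattice_path n -> ballot_path (2 * n).-1,
           is_zetaD_star g -> g =1 f)
      & bijective f].
Proof.
pose f (p : lattice_path n) : ballot_path (2 * n).-1 :=
  exist _ (zeta_star n (val p)) (zeta_star_ballot hn (valP p)).
have fE : is_zetaD_star f.
  move=> p; rewrite (star_zetaD_zeta_star hn (w := star (val p))) //.
  exact: star_is_lattice.
exists f; split=> // [g gE p|].
  have [r <-] := star_lattice_surj p.
  by apply: val_inj; rewrite gE fE.
have f_inj : injective f.
  by move=> p q [E]; apply/val_inj/(zeta_star_inj hn (valP p) (valP q)).
have f_surj v : exists p, f p == v.
  have [w Lw E] := zeta_star_surj hn (valP v).
  by exists (exist _ w Lw); apply/eqP/val_inj.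
have fK : cancel (fun v => xchoose (f_surj v)) f.
  by move=> v; apply/eqP/(xchooseP (f_surj v)).
by exists (fun v => xchoose (f_surj v)) => // p; apply: f_inj; rewrite fK.
Qed.
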